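(* Let $n\ge 1$ and let $J\subseteq\{1,\dots,n-1\}$. For each positive divisor $d$ of $n$, let $J^d$ be the set of elements of $J$ divisible by $d$, write $J^d=\{j^d_1<j^d_2<\cdots<j^d_{|J^d|}\}$, and put $j^d_0=0$ and $j^d_{|J^d|+1}=n$. Then the number of $n$-cycles in $S_n$ with descent set $J$ is $$\frac1n\sum_{d\mid n}\mu(d)\,(-1)^{|J|-|J^d|}\,\det\left(\binom{\frac nd-\frac{j^d_l}{d}}{\frac{j^d_{m+1}}{d}-\frac{j^d_l}{d}}\right)_{0\le l,m\le |J^d|},$$ where $\mu$ is the Möbius function.
   Context: A permutation $\pi\in S_n$ has a descent at position $i$ ($1\le i\le n-1$) if $\pi(i)>\pi(i+1)$. In this statement ''descent set $J$'' means that the set of descent positions in $\{1,\dots,n-1\}$ is $J$ (the position $n$ is not counted). An $n$-cycle is a permutation in $S_n$ consisting of a single cycle of length $n$. Binomial coefficients $\binom{x}{y}$ with $y<0$ are $0$. *)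

(* Defs.v *)
From mathcomp Require Import all_boot all_order all_fingroup all_algebra.

Set Implicit Arguments.
Unset Strict Implicit.
Unset Printing Implicit Defensive.

Import GRing.Theory.
Local Open Scope ring_scope.

(* The letter k of {1, ..., n} is the ordinal k - 1, so that a descent
   s(j) > s(j+1) at the (1-based) position j compares the images of the
   ordinals j - 1 and j. A position j, with 1 <= j <= n - 1, is itself
   represented by the ordinal j : 'I_n, without shift; 0 is never a position. *)
Definition descent_set (n : nat) (s : 'S_n) : {set 'I_n} :=
  [set j : 'I_n | [exists i : 'I_n, (i.+1 == j :> nat) && (s j < s i)%N]].

Definition is_ncycle (n : nat) (s : 'S_n) : bool :=
  porbits s == [set [set: 'I_n]].

Definition moebius (d : nat) : int :=
  if all (fun p => logn p d == 1%N) (primes d)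
  then (-1) ^+ size (primes d) else 0.

Definition binz (x : nat) (y : int) : int :=
  match y with
  | Posz k => 'C(x, k)%:Z
  | Negz _ => 0
  end.

Definition multiples_in (n : nat) (J : {set 'I_n}) (d : nat) : {set 'I_n} :=
  [set j in J | (d %| j)%N].

(* The sequence 0 = j_0, j_1 < ... < j_r, j_{r+1} = n, with K = {j_1, ..., j_r};
   [enum] lists a set of ordinals in increasing order. *)
Definition bordered (n : nat) (K : {set 'I_n}) : seq nat :=
  0%N :: rcons [seq val j | j <- enum K] n.

Lemma bordered_sorted (n : nat) (K : {set 'I_n}) :
  (0 < n)%N -> (forall j, j \in K -> (0 < j)%N) -> sorted ltn (bordered K).
Proof.
move=> n_gt0 K_gt0; rewrite /bordered /= rcons_path.
have sK : sorted ltn [seq val j | j <- enum K].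
  rewrite {1}/enum_mem -enumT sorted_map; apply: sorted_filter.
    by move=> y x z /=; apply: ltn_trans.
  by rewrite -(sorted_map (f := val)) val_enum_ord iota_ltn_sorted.
apply/andP; split.
  rewrite path_min_sorted //; apply/allP => _ /mapP[j jK ->].
  by apply: K_gt0; rewrite mem_enum in jK.
case: (lastP (enum K)) => [//|t j]; rewrite map_rcons last_rcons.
exact: ltn_ord.
Qed.

Definition descent_mx (n : nat) (J : {set 'I_n}) (d : nat) :
    'M[int]_(#|multiples_in J d|.+1) :=
  let j := nth 0%N (bordered (multiples_in J d)) in
  \matrix_(l, m)
    binz (n %/ d - j l %/ d)%N ((j m.+1 %/ d)%N%:Z - (j l %/ d)%N%:Z).

(* Main.v *)
Require Import Defs.
From mathcomp Require Import all_boot all_order all_fingroup all_algebra.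
From mathcomp Require Import zify ring.

(* J cuts {1, ..., n} into blocks, and s has its descents inside J exactly when it
   increases on every block. Reading the blocks of x, s x, s^2 x, ... turns such
   an n-cycle s, pointed at x, into a primitive word in which each block occurs
   as often as its size. The order of the points x, s x, ... is the
   lexicographic order of the rotations of that word, so this is a bijection
   (Gessel and Reutenauer). Moebius inversion over the periods counts the
   primitive words by multinomial coefficients, inclusion-exclusion over the
   subsets of J passes from "inside J" to "equal to J", and the resulting
   alternating sums of multinomials obey the recursion given by expanding the
   Hessenberg determinants along their first column. *)

Set Implicit Arguments.
Unset Strict Implicit.
Unset Printing Implicit Defensive.

Import GRing.Theory.
Local Open Scope ring_scope.

(** * The Moebius function *)

Lemma primes_mul_prime (p d : nat) :
  prime p -> (0 < d)%N -> ~~ (p %| d)%N -> perm_eq (primes (p * d)) (p :: primes d).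
Proof.
move=> p_pr d_gt0 pNd; apply: uniq_perm => [||q]; first exact: primes_uniq.
  by rewrite /= primes_uniq mem_primes (negPf pNd) !andbF.
by rewrite primesM ?(prime_gt0 p_pr) // (primes_prime p_pr) !in_cons orbF.
Qed.

Lemma moebius_mul_prime (p d : nat) :
  prime p -> (0 < d)%N ->
  moebius (p * d) = if (p %| d)%N then 0 else - moebius d.
Proof.
move=> p_pr d_gt0; have p_gt0 := prime_gt0 p_pr; rewrite /moebius.
have [pd | pNd] := boolP (p %| d)%N.
  rewrite ifN //; apply/allPn; exists p.
    by rewrite mem_primes p_pr muln_gt0 p_gt0 d_gt0 dvdn_mulr.
  rewrite lognM // logn_prime // eqxx add1n eqSS -lt0n logn_gt0 mem_primes.
  by rewrite p_pr d_gt0.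
have pE := primes_mul_prime p_pr d_gt0 pNd.
rewrite (perm_all _ pE) (perm_size pE) /= exprS mulN1r lognM //.
have -> : logn p d = 0%N by apply: logn_coprime; rewrite prime_coprime.
rewrite logn_prime // eqxx addn0 /=.
have -> : all (fun q => logn q (p * d) == 1%N) (primes d)
        = all (fun q => logn q d == 1%N) (primes d).
  apply: eq_in_all => q; rewrite mem_primes => /and3P[q_pr _ qd].
  rewrite lognM // logn_prime //; have [qp|//] := eqVneq q p.
  by rewrite -qp qd in pNd.
by case: ifP; rewrite ?oppr0.
Qed.

(** For a prime p with m = p m', the divisors of m are the p d with d dividing m', and the divisors
    of m' prime to p. As [moebius (p * d)] is 0 or the opposite of [moebius d], the two families
    cancel. *)
Lemma sum_moebius (m : nat) :
  (0 < m)%N -> \sum_(d <- divisors m) moebius d = (m == 1%N)%:R.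
Proof.
move=> m_gt0; have [->|m_neq1] := eqVneq m 1%N.
  by rewrite big_seq1.
have m_gt1 : (1 < m)%N by lia.
set p := pdiv m; have p_pr : prime p by apply: pdiv_prime.
have p_gt0 := prime_gt0 p_pr.
have [m' mE] : exists m', m = (p * m')%N.
  by exists (m %/ p)%N; rewrite mulnC divnK // pdiv_dvd.
clearbody p; subst m; have m'_gt0 : (0 < m')%N by lia.
rewrite (bigID (fun d => p %| d)%N) /=.
have multE : perm_eq [seq d <- divisors (p * m') | (p %| d)%N]
                     [seq (p * d)%N | d <- divisors m'].
  apply: uniq_perm => [||d].
  - by rewrite filter_uniq // divisors_uniq.
  - rewrite map_inj_uniq ?divisors_uniq // => a b /eqP.
    by rewrite eqn_pmul2l // => /eqP.
  rewrite mem_filter -dvdn_divisors //; apply/andP/mapP.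
    case=> /dvdnP[e ->]; rewrite mulnC dvdn_pmul2l // => em.
    by exists e => //; rewrite -dvdn_divisors.
  case=> e; rewrite -dvdn_divisors // => em ->.
  by rewrite dvdn_mulr // dvdn_pmul2l.
have coE : perm_eq [seq d <- divisors (p * m') | ~~ (p %| d)%N]
                   [seq d <- divisors m' | ~~ (p %| d)%N].
  apply: uniq_perm => [||d]; try by rewrite filter_uniq // divisors_uniq.
  rewrite !mem_filter -!dvdn_divisors //.
  case: (boolP (p %| d)%N) => //= pNd.
  by rewrite Gauss_dvdr // coprime_sym prime_coprime.
rewrite -big_filter (perm_big _ multE) big_map.
rewrite -[X in _ + X]big_filter (perm_big _ coE) big_filter.
have muE : {in divisors m', forall d,
    moebius (p * d) = if (p %| d)%N then 0 else - moebius d}.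
  move=> d; rewrite -dvdn_divisors // => dm; apply: moebius_mul_prime => //.
  exact: dvdn_gt0 dm.
rewrite (eq_big_seq _ muE) [in X in _ + X]big_mkcond -big_split big1 //= => d _.
by case: ifP; rewrite ?addr0 // addNr.
Qed.

(** * Words with prescribed letter multiplicities *)

Lemma size_permutations_rem (T : eqType) (s : seq T) :
  (0 < size s)%N ->
  size (permutations s) = (\sum_(x <- undup s) size (permutations (rem x s)))%N.
Proof.
move=> s_gt0; rewrite (perm_size (permutationsE s_gt0)).
rewrite size_allpairs_dep.
by rewrite sumnE big_map.
Qed.

Lemma sum_count_undup (T : eqType) (s : seq T) :
  (\sum_(x <- undup s) count_mem x s = size s)%N.
Proof.
rewrite -(sum1_size s) -[RHS](big_undup_iterop_count) /=; apply: eq_bigr => x _.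
by rewrite Monoid.iteropE iter_addn_0 mul1n.
Qed.

(* Enlarging the index set from [undup s] to any [r] containing it keeps [r]
   fixed along the induction; the extra factors are 0! = 1. *)
Lemma size_permutations_fact (T : eqType) (s r : seq T) :
  uniq r -> {subset s <= r} ->
  (size (permutations s) * \prod_(z <- r) (count_mem z s)`! = (size s)`!)%N.
Proof.
move=> r_uniq; move sz: (size s) => k; elim: k s sz => [|k IHk] s sz sr.
  by case: s sz sr => // _ _; rewrite big1.
rewrite size_permutations_rem ?sz // big_distrl /=.
transitivity (\sum_(x <- undup s) count_mem x s * k`!)%N; last first.
  by rewrite -big_distrl /= sum_count_undup sz factS.
rewrite big_seq [RHS]big_seq; apply: eq_bigr => x; rewrite mem_undup => xs.
have sz' : size (rem x s) = k by rewrite size_rem // sz.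
rewrite -(IHk _ sz'); last by move=> y /mem_rem; apply: sr.
rewrite mulnCA; congr (_ * _)%N.
rewrite (bigD1_seq x) ?sr //= [in RHS](bigD1_seq x) ?sr //= mulnA.
congr (_ * _)%N; last first.
  apply: eq_bigr => z zx; congr (_`!)%N.
  by rewrite count_mem_rem eq_sym (negPf zx) subn0.
have : (0 < count_mem x s)%N by rewrite -has_count has_pred1.
by rewrite count_mem_rem eqxx subn1; case: (count_mem x s) => // c _; rewrite factS.
Qed.

(** Since z is a new letter, the factorial formulas for the two words differ only in the length and
    in a factor c!; their quotient is the binomial. *)
Lemma size_permutations_nseq_cat (T : eqType) (c : nat) (z : T) (s : seq T) :
  z \notin s ->
  size (permutations (nseq c z ++ s)) =
  ('C(c + size s, c) * size (permutations s))%N.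
Proof.
move=> zs; set r := z :: undup s.
have r_uniq : uniq r by rewrite /= mem_undup zs undup_uniq.
have ssub : {subset s <= r} by move=> y ys; rewrite inE mem_undup ys orbT.
have csub : {subset nseq c z ++ s <= r}.
  move=> y; rewrite mem_cat => /orP[|/ssub//].
  by move/nseqP => [-> _]; rewrite mem_head.
have := size_permutations_fact r_uniq csub.
have := size_permutations_fact r_uniq ssub.
rewrite size_cat size_nseq !big_cons count_cat count_nseq /= eqxx mul1n.
have -> : count_mem z s = 0%N by apply/count_memPn.
rewrite fact0 mul1n addn0.
have -> : (\prod_(j <- undup s) (count_mem j (nseq c z ++ s))`! =
           \prod_(j <- undup s) (count_mem j s)`!)%N.
  rewrite big_seq [RHS]big_seq; apply: eq_bigr => y; rewrite mem_undup => ys.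
  rewrite count_cat count_nseq /=; case: eqP => [zy|_]; last by rewrite mul0n.
  by rewrite zy ys in zs.
set P := bigop _ _ _ => sE csE.
have P_gt0 : (0 < c`! * P)%N.
  rewrite muln_gt0 fact_gt0 prodn_cond_gt0 // => y _; exact: fact_gt0.
apply/eqP; rewrite -(eqn_pmul2r P_gt0) csE.
rewrite -(bin_fact (leq_addr (size s) c)) addKn -sE; apply/eqP; ring.
Qed.

Lemma size_permutations_map (T1 T2 : eqType) (f : T1 -> T2) (s : seq T1) :
  injective f -> size (permutations (map f s)) = size (permutations s).
Proof.
move=> f_inj; have u1 := undup_uniq s.
have u2 : uniq (map f (undup s)) by rewrite map_inj_uniq.
have s1 : {subset s <= undup s} by move=> y; rewrite mem_undup.
have s2 : {subset map f s <= map f (undup s)}.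
  by move=> _ /mapP[y ys ->]; rewrite map_f ?mem_undup.
have := size_permutations_fact u2 s2; have := size_permutations_fact u1 s1.
rewrite size_map big_map => <-.
rewrite (eq_bigr (fun y => (count_mem y s)`!)%N); last first.
  by move=> y _; rewrite count_map; congr (_`!)%N; apply: eq_count => a /=; rewrite inj_eq.
move/eqP; rewrite eqn_pmul2r => [/eqP //|].
by rewrite prodn_cond_gt0 // => y _; exact: fact_gt0.
Qed.

Lemma map_const_nseq (T1 T2 : Type) (x : T2) (s : seq T1) :
  [seq x | _ <- s] = nseq (size s) x.
Proof. by elim: s => //= _ s ->. Qed.

(** Letters start at 0, so a cut at position k separates k - 1 from k, and the cuts k <= a number
    the block of a. *)
Definition block (ks : seq nat) (a : nat) : nat := count (fun k => k <= a)%N ks.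

(** The multinomial coefficient of the successive gaps from x to N; the last gap takes all that
    remains and gives the factor 1. *)
Fixpoint multi (N x : nat) (s : seq nat) : nat :=
  if s is y :: s' then ('C(N - x, y - x) * multi N y s')%N else 1%N.

Lemma size_permutations_block (N x : nat) (s : seq nat) :
  path ltn x s -> all (fun y => y <= N)%N (x :: s) ->
  size (permutations [seq block s a | a <- iota x (N - x)]) = multi N x s.
Proof.
elim: s x => [|y s IHs] x /=.
  move=> _ _.
  have -> : [seq block [::] a | a <- iota x (N - x)] = nseq (N - x) 0%N ++ [::].
    by rewrite cats0 -{2}(size_iota x (N - x)) -map_const_nseq.
  by rewrite size_permutations_nseq_cat //= addn0 binn.
move=> /andP[xy ys] /and3P[xN yN sN].
(* The letters x, ..., y - 1 precede every cut and form block 0; from y on, the cut y adds one to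
   each block number. *)
have -> : [seq block (y :: s) a | a <- iota x (N - x)] =
  nseq (y - x) 0%N ++ [seq a.+1 | a <- [seq block s a | a <- iota y (N - y)]].
  have -> : (N - x = (y - x) + (N - y))%N by lia.
  rewrite iotaD map_cat; congr (_ ++ _).
    rewrite -{2}(size_iota x (y - x)) -map_const_nseq; apply/eq_in_map => a.
    rewrite mem_iota /block /= => aI.
    have -> : (y <= a)%N = false by lia.
    rewrite add0n; apply/eqP; rewrite eqn0Ngt -has_count -all_predC.
    have /allP ysP : all (ltn y) s by apply: order_path_min ys => a' b c; apply: ltn_trans.
    by apply/allP => z /ysP /=; lia.
  have -> : (x + (y - x) = y)%N by lia.
  rewrite -map_comp; apply/eq_in_map => a; rewrite mem_iota /block /= => aI.
  by have -> : (y <= a)%N by lia.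
rewrite size_permutations_nseq_cat; last by apply/mapP => -[].
rewrite size_permutations_map; last exact: succn_inj.
rewrite IHs //= ?yN // !size_map size_iota; congr ('C(_, _) * _)%N; lia.
Qed.

(** * Hessenberg determinants of binomials *)

(** The sum of [multi] over the sublists of s, signed by the number of entries left out: y is kept
    or dropped. *)
Fixpoint beta (N x : nat) (s : seq nat) : int :=
  if s is y :: s' then 'C(N - x, y - x)%:Z * beta N y s' - beta N x s' else 1.

Lemma binz_sub (N x y : nat) :
  (x <= y)%N -> binz N (y%:Z - x%:Z) = 'C(N, y - x)%:Z.
Proof. by move=> xy; rewrite subzn. Qed.

Lemma binz_sub_lt (N x y : nat) : (y < x)%N -> binz N (y%:Z - x%:Z) = 0.
Proof.
move=> yx; have -> : y%:Z - x%:Z = Negz (x - y).-1 by lia.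
by [].
Qed.

(* The matrix is upper Hessenberg with subdiagonal 1; only its first row depends
   on [x], so both minors in the expansion along the first column are again of
   this shape. *)
Lemma det_binz (N x : nat) (s : seq nat) (k : nat) :
  k = size s -> path ltn x s -> all (fun y => y <= N)%N (x :: s) ->
  \det (\matrix_(i < k.+1, j < k.+1)
    binz (N - nth 0%N (x :: s) i)
      ((nth 0%N (rcons s N) j)%:Z - (nth 0%N (x :: s) i)%:Z)) = beta N x s.
Proof.
elim: s x k => [|y s IHs] x _ -> /=.
  by rewrite andbT => _ xN; rewrite det_mx11 mxE /= binz_sub // binn.
move=> /andP[xy ys] /and3P[xN yN sN].
have xs : path ltn x s.
  by case: (s) ys => //= z t /andP[yz ->]; rewrite (ltn_trans xy yz).
have /allP ysP : all (ltn y) s.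
  by apply: order_path_min ys => a b c; apply: ltn_trans.
(* Past the first two rows, the first column has lower index y - z with z in s, which is negative;
   two cofactors remain. *)
rewrite (expand_det_col _ 0) !big_ord_recl big1 => [|i _]; last first.
  rewrite !mxE /= binz_sub_lt ?mul0r //.
  by apply: ysP; apply: mem_nth; case: i => i /=; lia.
rewrite !mxE /= !binz_sub ?subnn ?bin0 ?mul1r ?addr0 ?(ltnW xy) //.
rewrite /cofactor /= /bump /= expr0 expr1 mul1r mulN1r.
congr (_ * _ - _).
  rewrite -(IHs y (size s)) //= ?yN //; congr (\det _).
  by apply/matrixP => i j; rewrite !mxE /= /bump /= ?add1n /=.
rewrite -(IHs x (size s)) //= ?xN //; congr (\det _).
apply/matrixP => i j; rewrite !mxE /= /bump /= ?add1n /=.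
by case: i => -[|i] Hi //=.
Qed.

Lemma sorted_bordered_div (n : nat) (J : {set 'I_n}) (d : nat) :
  (0 < n)%N -> (d %| n)%N -> (forall j : 'I_n, j \in J -> (0 < j)%N) ->
  sorted ltn [seq (j %/ d)%N | j <- bordered (multiples_in J d)].
Proof.
move=> n_gt0 dn J_gt0; rewrite sorted_map.
have d_gt0 := dvdn_gt0 n_gt0 dn.
have dvd j : j \in bordered (multiples_in J d) -> (d %| j)%N.
  rewrite inE mem_rcons inE => /or3P[/eqP->|/eqP->|] //.
  by case/mapP => i; rewrite mem_enum inE => /andP[_ di] ->.
have : sorted ltn (bordered (multiples_in J d)).
  by apply: bordered_sorted => // j; rewrite inE => /andP[/J_gt0].
apply: sub_in_sorted (allss _) => a b /dvd da /dvd db /= ab.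
by rewrite ltn_divLR // divnK.
Qed.

Lemma det_descent_mx (n : nat) (J : {set 'I_n}) (d : nat) :
  (0 < n)%N -> (d %| n)%N -> (forall j : 'I_n, j \in J -> (0 < j)%N) ->
  \det (descent_mx J d) =
  beta (n %/ d) 0 [seq (val j %/ d)%N | j <- enum (multiples_in J d)].
Proof.
move=> n_gt0 dn J_gt0; have := sorted_bordered_div n_gt0 dn J_gt0.
rewrite /= div0n map_rcons -map_comp.
set s := [seq (val j %/ d)%N | j <- enum (multiples_in J d)] => sP.
have szs : #|multiples_in J d| = size s by rewrite size_map -cardE.
move: sP; rewrite rcons_path => /andP[sP _].
have sN : all (fun y => y <= n %/ d)%N (0%N :: s).
  rewrite /=; apply/allP => _ /mapP[j _ ->] /=.
  by apply: leq_div2r; apply: ltnW.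
rewrite -(det_binz szs sP sN); congr (\det _).
have bE : [seq (j %/ d)%N | j <- bordered (multiples_in J d)]
        = 0%N :: rcons s (n %/ d)%N.
  by rewrite /= div0n map_rcons -map_comp.
have szb : size (bordered (multiples_in J d)) = (size s).+2.
  by rewrite -(size_map (fun j => j %/ d)%N) bE /= size_rcons.
(* Both l and m + 1 stay within the bordered list, so the quotient by d passes inside [nth]. *)
apply/matrixP => l m; rewrite !mxE -!(nth_map 0%N 0%N (fun j => j %/ d)%N) ?szb;
  last 2 first.
- by rewrite ltnS -szs.
- by rewrite ltnS ltnW // -szs.
rewrite bE -rcons_cons nth_rcons /= -szs.
have -> : (l < #|multiples_in J d|.+1)%N by exact: ltn_ord.
by [].
Qed.

(** * From cycles to primitive words *)

Lemma is_ncycleP (n : nat) (s : 'S_n.+1) (x : 'I_n.+1) :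
  reflect (forall y, y \in porbit s x) (is_ncycle s).
Proof.
apply: (iffP eqP) => [sE y | sx].
  have : porbit s x \in porbits s by apply: imset_f.
  by rewrite sE inE => /eqP->.
have xE : porbit s x = [set: 'I_n.+1] by apply/setP => y; rewrite sx inE.
apply/setP => A; rewrite inE; apply/imsetP/eqP => [[y _ ->]|->].
  by rewrite -xE; apply/eqP; rewrite eq_porbit_mem sx.
by exists x.
Qed.

Lemma card_porbit_ncycle (n : nat) (s : 'S_n.+1) (x : 'I_n.+1) :
  is_ncycle s -> #|porbit s x| = n.+1.
Proof.
move=> /(is_ncycleP s x) sx; rewrite -[RHS](card_ord n.+1).
by apply: eq_card => y; rewrite sx.
Qed.

Lemma iter_ncycle (n : nat) (s : 'S_n.+1) (x : 'I_n.+1) :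
  is_ncycle s -> iter n.+1 s x = x.
Proof. by move=> /(card_porbit_ncycle x) sx; have := iter_porbit s x; rewrite sx. Qed.

Lemma iter_modn (T : Type) (g : T -> T) (m : nat) (x : T) (i : nat) :
  iter m g x = x -> iter (i %% m) g x = iter i g x.
Proof.
move=> gx; rewrite {2}(divn_eq i m) addnC iterD; congr iter.
by elim: (i %/ m)%N => //= q IHq; rewrite mulSn iterD -IHq gx.
Qed.

Lemma ncycle_trans (n : nat) (s : 'S_n.+1) (x y : 'I_n.+1) :
  is_ncycle s -> exists i, iter i s x = y.
Proof.
move=> /(is_ncycleP s x)/(_ y); rewrite porbit_traject => /trajectP[i _ ->].
by exists i.
Qed.

Lemma perm_traject_ncycle (n : nat) (s : 'S_n.+1) (x : 'I_n.+1) :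
  is_ncycle s -> perm_eq (traject s x n.+1) (enum 'I_n.+1).
Proof.
move=> sC; have sx := card_porbit_ncycle x sC; apply: uniq_perm.
- by have := uniq_traject_porbit s x; rewrite sx.
- exact: enum_uniq.
- by move=> y; have := porbit_traject s x y; rewrite sx mem_enum (is_ncycleP s x sC).
Qed.

(** Applied to the orbit enumeration of a cycle, this reads a point off its comparisons with the
    other points. *)
Lemma ord_card_lt (n : nat) (F : 'I_n -> 'I_n) (b : 'I_n) :
  injective F -> b = #|[pred j | F j < b]%N| :> nat.
Proof.
move=> F_inj; rewrite -(card_image F_inj).
rewrite (eq_card (B := [pred a : 'I_n | a < b]%N)).
  rewrite -sum1_card big_mkcond /= -(big_mkord xpredT (fun a => if a < b then 1 else 0)%N).
  rewrite (big_cat_nat (n := b)) //= ?[X in (X + _)%N]big_nat ?[X in (_ + X)%N]big_nat; last exact: ltnW.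
  rewrite (eq_bigr (fun=> 1%N)) => [|i /andP[_ ->] //].
  rewrite -big_nat sum_nat_const_nat subn0 muln1 big1 ?addn0 //.
  by move=> i /andP[bi _]; rewrite ltnNge bi.
move=> a; rewrite !inE; apply/imageP/idP => [[j]|ab].
  by rewrite inE => ? ->.
have [g Fg gF] := injF_bij F_inj.
by exists (g a); rewrite ?inE gF.
Qed.

Definition block_increasing (n : nat) (f : 'I_n -> nat) (s : 'S_n) : bool :=
  [forall a : 'I_n, forall b : 'I_n,
     (a < b)%N && (f a == f b) ==> (s a < s b)%N].

Lemma block_increasingP (n : nat) (f : 'I_n -> nat) (s : 'S_n) :
  reflect (forall a b : 'I_n, (a < b)%N -> f a = f b -> (s a < s b)%N)
          (block_increasing f s).
Proof.
apply: (iffP forallP) => [sI a b ab fab | sI a].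
  by have /forallP/(_ b) := sI a; rewrite ab fab eqxx.
by apply/forallP => b; apply/implyP => /andP[ab /eqP]; apply: sI.
Qed.

Definition word (n : nat) (f : 'I_n -> nat) (s : 'S_n) (x : 'I_n) : seq nat :=
  [seq f y | y <- traject s x n].

(** A cyclic period: rotation by e fixes w. It need not divide the length, and the length itself is
    always one. *)
Definition period (w : seq nat) (e : nat) : bool :=
  all (fun i => nth 0%N w ((i + e) %% size w) == nth 0%N w i) (iota 0 (size w)).

Definition primitive (w : seq nat) : bool :=
  ~~ has (period w) (iota 1 (size w).-1).

Section Standardization.

Variables (n : nat) (f : 'I_n.+1 -> nat).
Hypothesis f_mono : forall a b : 'I_n.+1, (a <= b)%N -> (f a <= f b)%N.

Implicit Types (s t : 'S_n.+1) (x y z : 'I_n.+1).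

(** The orbit of x passes through the largest letter, where the strict inequality fails. *)
Lemma ncycle_no_lt s x y :
  is_ncycle s -> ~ (forall l, iter l s x < iter l s y)%N.
Proof.
move=> sC lt; have [l lE] := ncycle_trans x ord_max sC.
by have := lt l; rewrite lE /= ltnNge -ltnS ltn_ord.
Qed.

(** If x < y, equal letters let s carry the inequality along both orbits forever, against
    [ncycle_no_lt]. *)
Lemma ncycle_separated s x y :
  is_ncycle s -> block_increasing f s ->
  (forall l, f (iter l s x) = f (iter l s y)) -> x = y.
Proof.
move=> sC /block_increasingP sI; wlog xy : x y / (x < y)%N => [hw fE|fE].
  have [xy|yx|/val_inj//] := ltngtP x y; first exact: hw.
  by apply/esym/hw.
case: (ncycle_no_lt (x := x) (y := y) sC) => l.
by elim: l => //= l IHl; apply: sI.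
Qed.

(** The word alone orders the orbit. Were the comparison reversed for t, monotonicity of f would
    force the two letters at each step to agree, and both inequalities would persist forever. *)
Lemma ncycle_compare s t x y i j :
  is_ncycle s -> is_ncycle t -> block_increasing f s -> block_increasing f t ->
  (forall l, f (iter l s x) = f (iter l t y)) ->
  (iter i s x < iter j s x)%N -> (iter i t y < iter j t y)%N.
Proof.
move=> sC tC /block_increasingP sI /block_increasingP tI fE ltij.
rewrite ltnNge; apply/negP => leji.
suff lt l : (iter (l + i) s x < iter (l + j) s x)%N /\
            (iter (l + j) t y <= iter (l + i) t y)%N.
  apply: (ncycle_no_lt (x := iter i s x) (y := iter j s x) sC) => l.
  by rewrite -!iterD; case: (lt l).
elim: l => // l [lts let_]; rewrite !addSn /=.
have fs := f_mono (ltnW lts); have ft := f_mono let_.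
have fsE : f (iter (l + i) s x) = f (iter (l + j) s x).
  by apply/eqP; rewrite eqn_leq fs /= !fE.
split; first exact: sI.
move: let_; rewrite leq_eqVlt => /predU1P[/val_inj->//|let_].
by apply/ltnW/tI => //; rewrite -!fE.
Qed.

Lemma size_word s x : size (word f s x) = n.+1.
Proof. by rewrite size_map size_traject. Qed.

Lemma nth_word s x i :
  is_ncycle s -> nth 0%N (word f s x) (i %% n.+1) = f (iter i s x).
Proof.
move=> sC; rewrite (nth_map x) ?size_traject ?ltn_mod //.
by rewrite nth_traject ?ltn_mod // iter_modn // iter_ncycle.
Qed.

Lemma traject_inj s x :
  is_ncycle s -> injective (fun i : 'I_n.+1 => iter i s x).
Proof.
move=> sC i j; rewrite -(nth_traject s (ltn_ord i)) -(nth_traject s (ltn_ord j)) => /eqP.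
rewrite nth_uniq ?size_traject //; first by move/eqP/val_inj.
by rewrite (perm_uniq (perm_traject_ncycle x sC)) enum_uniq.
Qed.

(** By [ncycle_compare] the i-th points of the two orbits have equally many orbit points below them,
    hence coincide; i = 0 gives the base points, consecutive i the permutations. *)
Lemma word_inj s t x y :
  is_ncycle s -> is_ncycle t -> block_increasing f s -> block_increasing f t ->
  word f s x = word f t y -> (s, x) = (t, y).
Proof.
move=> sC tC sI tI wE.
have fE l : f (iter l s x) = f (iter l t y) by rewrite -!nth_word // wE.
have stE i : iter i s x = iter i t y.
  apply: val_inj; rewrite /= (ord_card_lt (iter i s x) (traject_inj (x := x) sC)).
  rewrite (ord_card_lt (iter i t y) (traject_inj (x := y) tC)).
  apply: eq_card => j; rewrite !inE; apply/idP/idP.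
    exact: ncycle_compare.
  by apply: ncycle_compare => // l; rewrite fE.
have xy : x = y := stE 0%N.
congr (_, _) => //; apply/permP => a.
have [i iE] := ncycle_trans x a sC.
by rewrite -{1}iE -iterS stE iterS -stE iE.
Qed.

Lemma perm_word s x : is_ncycle s -> perm_eq (word f s x) (codom f).
Proof. by move=> sC; apply/perm_map/perm_traject_ncycle. Qed.

(** A period e below the length would give s^e x and x the same letters forever, hence s^e x = x. *)
Lemma word_primitive s x :
  is_ncycle s -> block_increasing f s -> primitive (word f s x).
Proof.
move=> sC sI; apply/hasPn => e; rewrite mem_iota size_word => /andP[e_gt0 en].
apply/negP => /allP; rewrite size_word => wP.
have ex : iter e s x = x.
  apply: (ncycle_separated sC sI) => l; rewrite -iterD.
  rewrite -(nth_word x _ sC) -(nth_word x l sC) -modnDml.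
  by apply/eqP/wP; rewrite mem_iota ltn_mod.
have e_lt : (e < n.+1)%N by lia.
have := @traject_inj s x sC (Ordinal e_lt) ord0; rewrite /= ex => /(_ erefl).
by move/(congr1 val) => /=; lia.
Qed.

End Standardization.

(** * From primitive words to cycles *)

(* Base-B numerals of length n stand for the lexicographic order of the rotations
   of a word of length n with letters below B. *)
Fixpoint numeral (B : nat) (W : nat -> nat) (m i : nat) : nat :=
  if m is m'.+1 then (W i * B ^ m' + numeral B W m' i.+1)%N else 0%N.

Lemma numeralSr (B : nat) (W : nat -> nat) (m i : nat) :
  numeral B W m.+1 i = (B * numeral B W m i + W (i + m))%N.
Proof.
elim: m i => [|m IHm] i; first by rewrite /= addn0 expn0 muln1 muln0 addn0.
rewrite -[LHS]/(W i * B ^ m.+1 + numeral B W m.+1 i.+1)%N IHm /= expnS addSnnS; ring.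
Qed.

Lemma numeral_lt (B : nat) (W : nat -> nat) (m i : nat) :
  (forall j, W j < B)%N -> (numeral B W m i < B ^ m)%N.
Proof.
move=> WB; elim: m i => [|m IHm] i //=.
have := WB i; have := IHm i.+1; rewrite expnS.
set P := (B ^ m)%N; move=> h1 h2; have : (W i * P + P <= B * P)%N by nia.
by lia.
Qed.

Section PrimitiveNumeral.

Local Open Scope nat_scope.

Variables (n : nat) (w : seq nat).
Hypotheses (sz_w : size w = n.+1) (w_prim : primitive w).

Let W i := nth 0%N w (i %% n.+1).
Let B := (\max_(z <- w) z).+1.
(** The value of the rotation of w starting at i; as B exceeds every letter, values compare as
    rotations do lexicographically. *)
Let V := numeral B W n.+1.

Lemma letter_lt i : (W i < B)%N.
Proof.
by rewrite ltnS /W; apply: leq_bigmax_seq => //; rewrite mem_nth // sz_w ltn_mod.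
Qed.

Lemma letter_mod i j : i = j %[mod n.+1] -> W i = W j.
Proof. by rewrite /W => ->. Qed.

Lemma rot_value_mod i j : i = j %[mod n.+1] -> V i = V j.
Proof.
suff VE m : i = j %[mod n.+1] -> numeral B W m i = numeral B W m j by apply: VE.
elim: m i j => //= m IHm i j ij; rewrite (letter_mod ij).
by rewrite (IHm i.+1 j.+1) // -[i.+1]addn1 -[j.+1]addn1 -modnDml ij modnDml.
Qed.

(** The n letters shared by the rotations at i and i + 1; the leading letter of the former ends the
    latter. *)
Let r i := numeral B W n i.+1.

Lemma rot_value i : V i = (W i * B ^ n + r i)%N /\ V i.+1 = (B * r i + W i)%N.
Proof.
split; rewrite // /V numeralSr -/(r i); congr (_ + _)%N.
by apply: letter_mod; rewrite addSnnS modnDr.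
Qed.

Lemma rot_value_letter i j : (V i <= V j)%N -> (W i <= W j)%N.
Proof.
have [-> _] := rot_value i; have [-> _] := rot_value j.
have ri : (r j < B ^ n)%N := numeral_lt n j.+1 letter_lt.
by move: (B ^ n)%N ri => P ri; nia.
Qed.

(** With equal leading letters, both comparisons reduce to that of [r i] and [r j]. *)
Lemma rot_value_shift i j : W i = W j -> (V i < V j)%N = (V i.+1 < V j.+1)%N.
Proof.
have [-> ->] := rot_value i; have [-> ->] := rot_value j => ->.
by rewrite ltn_add2l ltn_add2r ltn_pmul2l.
Qed.

(** Equal values give equal leading letters and, after a shift, equal values again; for i < j the
    word would have period j - i. *)
Lemma rot_value_inj (i j : nat) :
  (i < n.+1)%N -> (j < n.+1)%N -> V i = V j -> i = j.
Proof.
wlog ij : i j / (i < j)%N => [hw|].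
  by move=> ? ? E; have [ij|ji|//] := ltngtP i j; [|symmetry]; apply: hw.
move=> _ jn VE.
have step a b : V a = V b -> W a = W b /\ V a.+1 = V b.+1.
  move=> Vab; have Wab : W a = W b.
    by apply/eqP; rewrite eqn_leq !rot_value_letter // Vab.
  split; first exact: Wab.
  have := rot_value_shift Wab; have := rot_value_shift (esym Wab).
  by rewrite Vab ltnn; case: ltngtP.
have VEl l : V (i + l) = V (j + l).
  by elim: l => [|l IHl]; rewrite ?addn0 // !addnS; have [] := step _ _ IHl.
case/hasP: w_prim; exists (j - i)%N.
  by rewrite mem_iota sz_w; lia.
apply/allP => a; rewrite mem_iota sz_w => /andP[_ an].
have -> : nth 0%N w a = W a by rewrite /W modn_small.
rewrite -/(W (a + (j - i))).
(* The shift l = a + i n makes i + l congruent to a, and j + l to a + (j - i), modulo n + 1. *)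
have -> : W a = W (i + (a + i * n)).
  apply: letter_mod; have -> : (i + (a + i * n) = i * n.+1 + a)%N by lia.
  by rewrite modnMDl.
have -> : W (a + (j - i)) = W (j + (a + i * n)).
  apply: letter_mod.
  have -> : (j + (a + i * n) = i * n.+1 + (a + (j - i)))%N by lia.
  by rewrite modnMDl.
by have [-> _] := step _ _ (VEl (a + i * n)%N).
Qed.

(** The index i does not count itself, so the number is at most n and [inord] never falls back to
    its default. *)
Definition rot_rank (i : 'I_n.+1) : 'I_n.+1 :=
  inord #|[pred j : 'I_n.+1 | V j < V i]%N|.

Lemma rot_rankE (i : 'I_n.+1) :
  rot_rank i = #|[pred j : 'I_n.+1 | V j < V i]%N| :> nat.
Proof.
rewrite inordK // -[X in (_ < X)%N](card_ord n.+1); apply: proper_card.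
by apply/properP; split; [apply/subsetP | exists i; rewrite ?inE ?ltnn].
Qed.

Lemma rot_rank_lt (i j : 'I_n.+1) : (rot_rank i < rot_rank j)%N = (V i < V j)%N.
Proof.
have lt (a b : 'I_n.+1) : (V a < V b)%N -> (rot_rank a < rot_rank b)%N.
  move=> Vab; rewrite !rot_rankE; apply: proper_card; apply/properP; split.
    by apply/subsetP => c; rewrite !inE => /ltn_trans; apply.
  by exists a; rewrite !inE ?ltnn.
apply/idP/idP => [rij|]; last exact: lt.
have [//|/lt|VE] := ltngtP (V i) (V j); first by rewrite ltnNge ltnW.
by rewrite (val_inj (rot_value_inj (ltn_ord i) (ltn_ord j) VE)) ltnn in rij.
Qed.

Lemma rot_rank_inj : injective rot_rank.
Proof.
move=> i j rE; apply/val_inj/(rot_value_inj (ltn_ord i) (ltn_ord j)).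
by have [h|h|//] := ltngtP (V i) (V j); move: h; rewrite -rot_rank_lt rE ltnn.
Qed.

(** The cyclic shift conjugated by the ranks: the rank of each rotation goes to the rank of the
    next. This inverts the reading of words. *)
Definition std_perm : 'S_n.+1 := (perm (@ordS_inj n.+1) ^ perm rot_rank_inj)%g.

Lemma std_permE i : std_perm (rot_rank i) = rot_rank (ordS i).
Proof. by rewrite -(permE rot_rank_inj i) permJ !permE. Qed.

Lemma iter_std_perm (i : 'I_n.+1) : iter i std_perm (rot_rank ord0) = rot_rank i.
Proof.
case: i => i; elim: i => [|i IHi] i_lt /=; first by congr rot_rank; apply: val_inj.
rewrite (IHi (ltnW i_lt)) std_permE; congr rot_rank; apply: val_inj => /=.
by rewrite modn_small.
Qed.

Lemma std_perm_ncycle : is_ncycle std_perm.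
Proof.
apply/(is_ncycleP _ (rot_rank ord0)) => y.
have [g rg gr] := injF_bij rot_rank_inj.
by rewrite -(gr y) -iter_std_perm -permX mem_porbit.
Qed.

Variable f : 'I_n.+1 -> nat.
Hypotheses (f_mono : forall a b : 'I_n.+1, (a <= b)%N -> (f a <= f b)%N).
Hypothesis fw : perm_eq w (codom f).

Lemma sorted_codom (g : 'I_n.+1 -> nat) :
  (forall a b : 'I_n.+1, (a <= b)%N -> (g a <= g b)%N) -> sorted leq (codom g).
Proof.
move=> g_mono; rewrite sorted_map.
apply: (sub_sorted (e := relpre val leq)) => [a b|]; first exact: g_mono.
by rewrite -sorted_map val_enum_ord iota_sorted.
Qed.

(** The leading letters of the rotations, listed by rank, form like [codom f] an increasing
    rearrangement of w, so the two lists agree. *)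
Lemma letter_rank i : f (rot_rank i) = nth 0%N w i.
Proof.
have [g rg gr] := injF_bij rot_rank_inj.
suff fE : codom f = codom (fun a => W (g a)).
  have := congr1 (fun s => nth 0%N s (enum_rank (rot_rank i))) fE.
  by rewrite /= !nth_codom enum_rankK rg => ->; rewrite /W modn_small.
apply: (sorted_eq leq_trans anti_leq).
- exact: sorted_codom.
- apply: sorted_codom => a b ab; apply: rot_value_letter.
  by rewrite leqNgt -rot_rank_lt !gr -leqNgt.
rewrite perm_sym -(permPr fw).
have -> : w = [seq W (val i) | i <- enum 'I_n.+1].
  rewrite (map_comp W val) val_enum_ord; apply: (@eq_from_nth _ 0%N) => [|k].
    by rewrite size_map size_iota.
  rewrite sz_w => k_lt.
  by rewrite (nth_map 0%N) ?size_iota // nth_iota // add0n /W modn_small.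
rewrite /codom /image_mem (map_comp (fun i : 'I_n.+1 => W i) g); apply: perm_map.
apply: uniq_perm => [||a].
- by rewrite (map_inj_uniq (can_inj gr)) enum_uniq.
- exact: enum_uniq.
- by rewrite -{1}(rg a) map_f mem_enum.
Qed.

(** Equal values of f mean equal leading letters, and then the shift preserves the order of the
    rotations. *)
Lemma std_perm_increasing : block_increasing f std_perm.
Proof.
have [g rg gr] := injF_bij rot_rank_inj.
apply/block_increasingP => a b; rewrite -(gr a) -(gr b); move: (g a) (g b) => i j.
rewrite rot_rank_lt !letter_rank !std_permE rot_rank_lt => Vij wij.
by rewrite !(@rot_value_mod (ordS _) _ (modn_mod _ _)) -rot_value_shift // /W !modn_small.
Qed.

Lemma word_std_perm : word f std_perm (rot_rank ord0) = w.
Proof.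
apply: (@eq_from_nth _ 0%N) => [|i]; rewrite size_word // => i_lt.
rewrite -{1}(modn_small i_lt) nth_word ?std_perm_ncycle //.
by rewrite -[i]/(val (Ordinal i_lt)) iter_std_perm letter_rank.
Qed.

End PrimitiveNumeral.

(** The factor n + 1 counts the base points x: pairs (s, x) correspond to primitive words. *)
Lemma card_ncycles_words (n : nat) (f : 'I_n.+1 -> nat) :
  (forall a b : 'I_n.+1, (a <= b)%N -> (f a <= f b)%N) ->
  (#|[set s : 'S_n.+1 | is_ncycle s && block_increasing f s]| * n.+1)%N =
  count primitive (permutations (codom f)).
Proof.
move=> f_mono; set A := [set s | _].
have -> : (#|A| * n.+1 = #|setX A [set: 'I_n.+1]|)%N by rewrite cardsX cardsT card_ord.
rewrite cardE -size_filter.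
rewrite -(size_map (fun q => word f q.1 q.2)); apply: perm_size.
apply: uniq_perm => [||w].
- rewrite map_inj_in_uniq ?enum_uniq // => -[s x] [t y].
  rewrite !mem_enum !inE !andbT => /andP[sC sI] /andP[tC tI].
  exact: word_inj.
- by rewrite filter_uniq // permutations_uniq.
rewrite mem_filter mem_permutations; apply/mapP/andP.
  case=> -[s x]; rewrite mem_enum !inE andbT => /andP[sC sI] ->.
  by rewrite perm_word // word_primitive.
case=> w_prim fw; have sz_w : size w = n.+1.
  by rewrite (perm_size fw) size_codom card_ord.
(* The word is read from offset 0, so the base point is the rank of that rotation. *)
exists (std_perm sz_w w_prim, rot_rank w ord0); last by rewrite /= (word_std_perm _ _ f_mono).
by rewrite mem_enum !inE andbT std_perm_ncycle (std_perm_increasing _ _ f_mono fw).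
Qed.

(** * Periods of words *)

Lemma periodP (w : seq nat) (e : nat) :
  (0 < size w)%N ->
  reflect (forall i, nth 0%N w ((i + e) %% size w) = nth 0%N w (i %% size w))
          (period w e).
Proof.
move=> w_gt0; apply: (iffP allP) => [wP i | wP i].
  by rewrite -modnDml; apply/eqP/wP; rewrite mem_iota ltn_mod.
by rewrite mem_iota => /andP[_ iw]; rewrite wP modn_small.
Qed.

(** The length is a period, so a least positive one exists; the remainder of any period modulo it is
    again a period, hence 0. *)
Lemma least_period (w : seq nat) :
  (0 < size w)%N ->
  exists2 e0, (0 < e0)%N & forall e, period w e = (e0 %| e)%N.
Proof.
move=> w_gt0.
have ex : exists e, (0 < e)%N && period w e.
  by exists (size w); rewrite w_gt0; apply/periodP => // i; rewrite modnDr.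
case: (ex_minnP ex) => e0 /andP[e0_gt0 /(periodP _ w_gt0) e0P] e0_min.
have mulP q i : nth 0%N w ((i + q * e0) %% size w) = nth 0%N w (i %% size w).
  by elim: q => [|q IHq]; rewrite ?addn0 // mulSnr addnA e0P.
exists e0 => // e; apply/idP/dvdnP => [/(periodP _ w_gt0) eP | [q ->]].
  exists (e %/ e0)%N; rewrite {1}(divn_eq e e0).
  suff -> : (e %% e0 = 0)%N by rewrite addn0.
  apply/eqP; rewrite -leqn0 leqNgt; apply/negP => r_gt0.
  have := ltn_mod e e0; rewrite e0_gt0 ltnNge e0_min // r_gt0.
  apply/periodP => // i; rewrite -(mulP (e %/ e0)%N) -addnA [(e %% _ + _)%N]addnC.
  by rewrite -divn_eq eP.
by apply/periodP.
Qed.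

(** With least period e0 and m = size w / e0, the quotient size w / d is a period exactly when d
    divides m. The Moebius sum over the divisors of m then detects m = 1, which is primitivity. *)
Lemma primitive_moebius (w : seq nat) :
  (0 < size w)%N ->
  (primitive w)%:Z =
  \sum_(d <- divisors (size w)) moebius d * (period w (size w %/ d))%:Z.
Proof.
move=> w_gt0; have [e0 e0_gt0 e0P] := least_period w_gt0.
have e0w : (e0 %| size w)%N.
  by rewrite -e0P; apply/periodP => // i; rewrite modnDr.
set m := (size w %/ e0)%N.
have szE : (size w = m * e0)%N by rewrite divnK.
have m_gt0 : (0 < m)%N by case: m szE => //; lia.
transitivity (\sum_(d <- divisors m) moebius d).
  rewrite sum_moebius // natz; congr (Posz (nat_of_bool _)).
  apply/idP/eqP => [/hasPn wP | m1].
    apply/eqP; rewrite eqn_leq m_gt0 andbT leqNgt; apply/negP => m_gt1.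
    have := wP e0; rewrite mem_iota e0P dvdnn; nia.
  apply/hasPn => e; rewrite mem_iota e0P szE m1 mul1n => eI.
  by apply/negP => /dvdn_leq; lia.
have mE : perm_eq (divisors m) [seq d <- divisors (size w) | (d %| m)%N].
  apply: uniq_perm => [||d]; rewrite ?filter_uniq ?divisors_uniq //.
  rewrite mem_filter -!dvdn_divisors //.
  by apply/idP/andP => [dm|[]//]; rewrite dm szE dvdn_mulr.
rewrite (perm_big _ mE) big_filter big_mkcond; apply: eq_big_seq => d.
rewrite -dvdn_divisors // e0P => dw; have d_gt0 := dvdn_gt0 w_gt0 dw.
by rewrite dvdn_divRL // mulnC -dvdn_divRL // -/m; case: ifP; rewrite ?mulr1 ?mulr0.
Qed.

Definition replicate (d : nat) (u : seq nat) : seq nat := flatten (nseq d u).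

Lemma count_replicate (P : pred nat) (d : nat) (u : seq nat) :
  count P (replicate d u) = (count P u * d)%N.
Proof. by rewrite count_flatten map_nseq sumn_nseq. Qed.

Lemma size_replicate (d : nat) (u : seq nat) :
  size (replicate d u) = (size u * d)%N.
Proof. by rewrite -!count_predT count_replicate. Qed.

Lemma nth_replicate (d : nat) (u : seq nat) (i : nat) :
  (i < size u * d)%N -> nth 0%N (replicate d u) i = nth 0%N u (i %% size u).
Proof.
elim: d i => [|d IHd] i; first by rewrite muln0.
rewrite mulnS /= nth_cat => i_lt; case: ltnP => [iu | ui]; first by rewrite modn_small.
by rewrite -/(replicate d u) IHd; [rewrite -[in RHS](subnK ui) modnDr | lia].
Qed.

Lemma perm_replicate (d : nat) (u v : seq nat) :
  (0 < d)%N -> perm_eq (replicate d u) (replicate d v) = perm_eq u v.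
Proof.
move=> d_gt0; apply/seq.permP/seq.permP => uv P.
  by have /eqP := uv P; rewrite !count_replicate eqn_pmul2r // => /eqP.
by rewrite !count_replicate uv.
Qed.

Lemma period_replicate (d e : nat) (w : seq nat) :
  (0 < d)%N -> (0 < e)%N -> size w = (e * d)%N ->
  period w e = (w == replicate d (take e w)).
Proof.
move=> d_gt0 e_gt0 sz_w.
have w_gt0 : (0 < size w)%N by rewrite sz_w muln_gt0 e_gt0.
have sz_u : size (take e w) = e by rewrite size_takel // sz_w leq_pmulr.
apply/periodP/eqP => // [wP | -> i].
  apply: (@eq_from_nth _ 0%N) => [|i i_lt]; first by rewrite size_replicate sz_u.
  rewrite nth_replicate ?sz_u -?sz_w // nth_take ?ltn_mod //.
  have qP q j : nth 0%N w ((j + q * e) %% size w) = nth 0%N w (j %% size w).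
    by elim: q => [|q IHq]; rewrite ?addn0 // mulSnr addnA wP.
  have := qP (i %/ e)%N (i %% e)%N; rewrite addnC -divn_eq modn_small // => ->.
  by rewrite modn_small //; apply: leq_ltn_trans i_lt; apply: leq_mod.
have szr : size (replicate d (take e w)) = (e * d)%N by rewrite size_replicate sz_u.
rewrite szr !nth_replicate ?sz_u ?ltn_mod ?muln_gt0 ?e_gt0 //.
by rewrite !modn_dvdm ?dvdn_mulr // modnDr.
Qed.

(** * Blocks and periodic words *)

Lemma block_mono (ks : seq nat) (a b : nat) :
  (a <= b)%N -> (block ks a <= block ks b)%N.
Proof. by move=> ab; apply: sub_count => k /= /leq_trans; apply. Qed.

Lemma block_lt (ks : seq nat) (k a : nat) :
  k \in ks -> (block ks a < block ks k)%N = (a < k)%N.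
Proof.
move=> kk; apply/idP/idP => [|ak].
  by apply: contraTltn => /(block_mono ks); rewrite leqNgt.
elim: ks kk => //= j ks IHks; rewrite in_cons => /predU1P[<-|/IHks lt].
  have := block_mono ks (ltnW ak); rewrite /block; lia.
by rewrite -addnS leq_add //; case: (leqP j a) => // /leq_trans->; rewrite // ltnW.
Qed.

(** This recovers a cut from letter multiplicities alone, so it applies to every rearrangement. *)
Lemma count_block_lt (ks : seq nat) (k N : nat) :
  k \in ks -> (k <= N)%N ->
  count (fun b => b < block ks k)%N [seq block ks a | a <- iota 0 N] = k.
Proof.
move=> kk kN; rewrite count_map (eq_count (a2 := fun a => a < k)%N); last first.
  by move=> a /=; rewrite block_lt.
rewrite -(subnKC kN) iotaD count_cat add0n.
have /eqP -> : count (fun a => a < k)%N (iota k (N - k)) == 0%N.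
  by rewrite eqn0Ngt -has_count -all_predC; apply/allP => a; rewrite mem_iota /=; lia.
rewrite addn0 -[RHS](size_iota 0); apply/eqP; rewrite -all_count.
by apply/allP => a; rewrite mem_iota.
Qed.

(** As d divides every cut, each interval i d, ..., i d + d - 1 lies in one block, that of i for the
    cuts divided by d. *)
Lemma perm_block_replicate (ks : seq nat) (d e : nat) :
  (0 < d)%N -> all (fun k => d %| k)%N ks ->
  perm_eq [seq block ks a | a <- iota 0 (e * d)]
          (replicate d [seq block [seq (k %/ d)%N | k <- ks] a | a <- iota 0 e]).
Proof.
move=> d_gt0 /allP dks; apply/seq.permP => P; rewrite count_replicate !count_map.
have cE (Q : pred nat) m : count Q (iota 0 m) = (\sum_(0 <= a < m) Q a)%N.
  by rewrite -sum1_count big_mkcond /index_iota subn0.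
rewrite !cE big_nat_mul big_distrl; apply: eq_bigr => i _.
rewrite [RHS](_ : _ = \sum_(i * d <= j < i.+1 * d)
    P (block [seq (k %/ d)%N | k <- ks] i))%N; last first.
  by rewrite sum_nat_const_nat mulSnr addKn mulnC.
apply: eq_big_nat => j /andP[ij ji] /=; congr (nat_of_bool (P _)).
rewrite /block count_map; apply: eq_in_count => k kk /=.
have -> : i = (j %/ d)%N by nia.
by rewrite leq_divRL // divnK // dks.
Qed.

(** Words with period e are d-fold repetitions of words of length e. Their letter counts are
    multiples of d, hence so are the cuts. *)
Lemma count_period_block (ks : seq nat) (d e : nat) :
  (0 < d)%N -> (0 < e)%N -> all (fun k => k <= e * d)%N ks ->
  count (period^~ e) (permutations [seq block ks a | a <- iota 0 (e * d)]) =
  if all (fun k => d %| k)%N ks then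
    size (permutations [seq block [seq (k %/ d)%N | k <- ks] a | a <- iota 0 e])
  else 0%N.
Proof.
move=> d_gt0 e_gt0 /allP ks_le; set bs := [seq block ks a | a <- _].
have sz_bs : size bs = (e * d)%N by rewrite size_map size_iota.
case: ifPn => [dks | /allPn[k kk dNk]]; last first.
  apply/eqP; rewrite eqn0Ngt -has_count; apply/hasPn => w.
  rewrite mem_permutations => wbs; have sz_w := perm_size wbs.
  rewrite (period_replicate d_gt0 e_gt0) ?sz_w //; apply: contra dNk => /eqP wE.
  move/seq.permP: wbs => /(_ (fun b => b < block ks k)%N).
  rewrite count_block_lt ?ks_le // => <-.
  by rewrite wE count_replicate dvdn_mull.
have bsE := perm_block_replicate e d_gt0 dks.
rewrite -size_filter -[RHS](size_map (replicate d)); apply: perm_size.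
have repK u : size u = e -> take e (replicate d u) = u.
  move=> sz_u; case: d d_gt0 {dks bsE bs sz_bs ks_le} => // d _.
  by rewrite /replicate /= take_size_cat.
have sz_perm u : u \in permutations
    [seq block [seq (k %/ d)%N | k <- ks] a | a <- iota 0 e] -> size u = e.
  by rewrite mem_permutations => /perm_size ->; rewrite size_map size_iota.
apply: uniq_perm => [||w].
- by rewrite filter_uniq // permutations_uniq.
- rewrite map_inj_in_uniq ?permutations_uniq // => u v /sz_perm su /sz_perm sv uv.
  by rewrite -(repK u su) uv repK.
rewrite mem_filter mem_permutations; apply/andP/mapP.
  case=> wP wbs; have sz_w : size w = (e * d)%N by rewrite (perm_size wbs).
  move: wP; rewrite (period_replicate d_gt0 e_gt0) // => /eqP wE.
  exists (take e w) => //; rewrite mem_permutations.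
  by rewrite -(perm_replicate _ _ d_gt0) -wE (perm_trans wbs).
case=> u uP ->; have su := sz_perm u uP.
rewrite (period_replicate d_gt0 e_gt0) ?size_replicate ?su // repK // eqxx.
by rewrite mem_permutations in uP; rewrite (permPr bsE) perm_replicate.
Qed.

(** * Inclusion-exclusion over descent sets *)

Lemma sum_subsetU1 (T : finType) (V : nmodType) (y : T) (L : {set T})
    (F : {set T} -> V) :
  y \notin L ->
  \sum_(K : {set T} | K \subset y |: L) F K =
  \sum_(K : {set T} | K \subset L) F K +
  \sum_(K : {set T} | K \subset L) F (y |: K).
Proof.
move=> yL; rewrite (bigID (fun K : {set T} => y \in K)) /= addrC; congr (_ + _).
  apply: eq_bigl => K; apply/andP/idP => [[/subsetP KyL yK]|KL].
    apply/subsetP => z zK; have := KyL z zK; rewrite in_setU1 => /predU1P[zy|//].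
    by rewrite -zy zK in yK.
  split; first exact: subset_trans KL (subsetUr _ _).
  by apply: contra yL; apply: subsetP.
rewrite (reindex_onto (fun K => y |: K) (fun K => K :\ y)) /=; last first.
  by move=> K /andP[_ yK]; rewrite setD1K.
apply: eq_bigl => K; rewrite setU11 andbT; apply/andP/idP => [[yKL /eqP KE]|KL].
  apply/subsetP => z; rewrite -KE in_setD1 => /andP[zy zK].
  by have := subsetP yKL z zK; rewrite in_setU1 (negPf zy).
have yK : y \notin K by apply: contra yL; apply: subsetP.
by rewrite setUS // setU1K.
Qed.

(** If D is a proper subset of J, take y in J outside D: adding y to K flips the sign and does not
    affect whether K contains D, so terms cancel in pairs. *)
Lemma subset_inclusion_exclusion (T : finType) (D J : {set T}) :
  \sum_(K : {set T} | K \subset J) (-1) ^+ (#|J| + #|K|) * (D \subset K)%:Z =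
  (D == J)%:Z.
Proof.
have [->|DJ] := eqVneq D J.
  rewrite (bigD1 J) //= subxx mulr1 addnn -mul2n exprM sqrrN !expr1n big1 ?addr0 //.
  move=> K /andP[KJ KJ']; have -> : J \subset K = false; last by rewrite mulr0.
  by apply/negP => JK; case/eqP: KJ'; apply/eqP; rewrite eqEsubset KJ.
have [DsJ | DNJ] := boolP (D \subset J); last first.
  rewrite big1 // => K KJ; have -> : D \subset K = false; last by rewrite mulr0.
  by apply: contraNF DNJ => /subset_trans; apply.
have /properP[_ [y yJ yD]] : D \proper J by rewrite properEneq DJ.
have yL : y \notin J :\ y by rewrite setD11.
rewrite -[in LHS](setD1K yJ) sum_subsetU1 // -big_split big1 //= => K KJ.
have yK : y \notin K by apply: contra yL; apply: subsetP.
rewrite [#|y |: K|]cardsU1 yK.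
have -> : D \subset y |: K = (D \subset K).
  apply/idP/idP => [/subsetP DyK | /subset_trans]; last by apply; apply: subsetUr.
  apply/subsetP => z zD; have := DyK z zD; rewrite in_setU1 => /predU1P[zy|//].
  by rewrite -zy zD in yD.
by rewrite addnCA exprS mulN1r mulNr subrr.
Qed.

(** The recursion of [beta] sorts the subsets by whether they contain the head of the list. *)
Lemma beta_sum_multi (T : finType) (N x : nat) (g : T -> nat) (l : seq T) :
  uniq l ->
  \sum_(K : {set T} | K \subset [set z in l])
    (-1) ^+ (size l + #|K|) * (multi N x [seq g z | z <- l & z \in K])%:Z =
  beta N x (map g l).
Proof.
elim: l x => [|y l IHl] x /=.
  move=> _; rewrite (big_pred1 set0) => [|K].
    by rewrite cards0 mulr1.
  by rewrite /= -subset0; congr (K \subset _); apply/setP => z; rewrite !inE.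
move=> /andP[yl l_uniq].
have -> : [set z in y :: l] = y |: [set z in l].
  by apply/setP => z; rewrite !inE.
rewrite sum_subsetU1 ?inE // -(IHl _ l_uniq) -(IHl _ l_uniq) addrC big_distrr /=.
rewrite -sumrN; congr (_ + _); apply: eq_bigr => K KL.
  have yK : y \notin K by apply: contra yl => /(subsetP KL); rewrite inE.
  (* The list and the subset both grow by one element, so the sign is unchanged. *)
  rewrite setU11 cardsU1 yK addSnnS add1n !addnS !exprS !mulN1r opprK /=.
  have -> : [seq z <- l | z \in y |: K] = [seq z <- l | z \in K].
    apply: eq_in_filter => z zl; rewrite in_setU1.
    by case: eqP => // zy; rewrite -zy zl in yl.
  by rewrite PoszM mulrCA.
have yK : y \notin K by apply: contra yl => /(subsetP KL); rewrite inE.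
by rewrite (negPf yK) addSn exprS mulN1r mulNr.
Qed.

Lemma enum_subset (T : finType) (K L : {set T}) :
  K \subset L -> enum K = [seq z <- enum L | z \in K].
Proof.
move=> /subsetP KL; rewrite /enum_mem -filter_predI; apply: eq_filter => z /=.
by apply/idP/andP => [zK|[]//]; split=> //; apply: KL.
Qed.

Lemma beta_sum_subset (n N : nat) (g : 'I_n -> nat) (L : {set 'I_n}) :
  \sum_(K : {set 'I_n} | K \subset L)
    (-1) ^+ (#|L| + #|K|) * (multi N 0 [seq g z | z <- enum K])%:Z =
  beta N 0 [seq g z | z <- enum L].
Proof.
rewrite -beta_sum_multi ?enum_uniq // set_enum -cardE.
by apply: eq_bigr => K KL; rewrite (enum_subset KL).
Qed.

(** Letters i and i + 1 share a block exactly when i + 1 is not in K; ascents between neighbours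
    chain up to whole blocks. *)
Lemma block_increasing_descent (n : nat) (K : {set 'I_n}) (s : 'S_n) :
  block_increasing (fun a : 'I_n => block [seq val j | j <- enum K] a) s =
  (descent_set s \subset K).
Proof.
set ks := [seq val j | j <- enum K].
have ksP (j : 'I_n) : (val j \in ks) = (j \in K).
  by rewrite mem_map ?mem_enum //; apply: val_inj.
apply/block_increasingP/subsetP => [sI j | sK].
  rewrite inE => /existsP[i /andP[/eqP ij sji]]; apply: contraTT sji => jK.
  rewrite -leqNgt; apply/ltnW/sI; first by rewrite -ij.
  rewrite -ij /block; apply: eq_in_count => k kk /=.
  have : k != i.+1; last by lia.
  by apply: contraNneq jK => kij; rewrite -ksP /= -ij -kij.
have lt1 (a b : 'I_n) : b = a.+1 :> nat -> block ks a = block ks b -> (s a < s b)%N.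
  move=> ba abE; rewrite ltnNge; apply/negP => sba.
  have bD : b \in descent_set s.
    rewrite inE; apply/existsP; exists a; rewrite ba eqxx /=.
    rewrite ltn_neqAle sba andbT; apply/eqP => /val_inj/perm_inj ab.
    by move: ba; rewrite ab; lia.
  have bks : val b \in ks by rewrite ksP sK.
  by have := block_lt a bks; rewrite /= abE ltnn ba ltnSn.
(* Induction on the distance m + 1; the intermediate letter lies in the same block by
   monotonicity. *)
suff lt m (a b : 'I_n) : b = (a + m.+1)%N :> nat -> block ks a = block ks b ->
    (s a < s b)%N.
  by move=> a b ab; apply: (lt (b - a).-1); lia.
elim: m b => [|m IHm] b bE abE; first by apply: lt1; rewrite // bE addn1.
have c_lt : (a + m.+1 < n)%N by have := ltn_ord b; lia.
pose c := Ordinal c_lt.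
have cb : b = c.+1 :> nat by rewrite bE /= addnS.
have acb : block ks a = block ks c.
  by apply/eqP; rewrite eqn_leq block_mono ?leq_addr //= abE block_mono // cb.
apply: (@ltn_trans (s c)); first exact: IHm.
by apply: lt1; rewrite // -acb.
Qed.

(** * Counting cycles by descent set *)

Lemma Posz_count (T : Type) (P : pred T) (s : seq T) :
  (count P s)%:Z = \sum_(x <- s) (P x)%:Z.
Proof. by elim: s => [|x s IHs]; rewrite ?big_nil // big_cons -IHs -PoszD. Qed.

(** Moebius inversion is applied word by word before the sums are exchanged;
    [K \subset multiples_in K d] says that d divides all of K. *)
Lemma count_ncycles_descent_sub (n : nat) (K : {set 'I_n.+1}) :
  (forall j : 'I_n.+1, j \in K -> (0 < j)%N) ->
  (#|[set s : 'S_n.+1 | is_ncycle s && (descent_set s \subset K)]| * n.+1)%N%:Z =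
  \sum_(d <- divisors n.+1) moebius d *
    (if K \subset multiples_in K d
     then (multi (n.+1 %/ d) 0 [seq (val j %/ d)%N | j <- enum K])%:Z else 0).
Proof.
move=> K_gt0; set ks := [seq val j | j <- enum K].
have f_mono (a b : 'I_n.+1) : (a <= b)%N -> (block ks a <= block ks b)%N.
  exact: block_mono.
have := card_ncycles_words f_mono.
set A := [set s | _]; set A' := [set s | _].
have -> : A = A' by apply/setP => s; rewrite !inE block_increasing_descent.
move=> ->.
have -> : codom (fun a : 'I_n.+1 => block ks a) = [seq block ks a | a <- iota 0 n.+1].
  by rewrite -val_enum_ord -map_comp.
set us := permutations _.
have sz_us w : w \in us -> size w = n.+1.
  by rewrite mem_permutations => /perm_size ->; rewrite size_map size_iota.
rewrite Posz_count.
have usE : {in us, forall w, (primitive w)%:Z =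
    \sum_(d <- divisors n.+1) moebius d * (period w (n.+1 %/ d))%:Z}.
  by move=> w /sz_us sz_w; rewrite primitive_moebius sz_w.
rewrite (eq_big_seq _ usE) exchange_big /=; apply: eq_big_seq => d.
rewrite -dvdn_divisors // => dn; rewrite -big_distrr /=; congr (_ * _).
have d_gt0 : (0 < d)%N := dvdn_gt0 (ltn0Sn n) dn.
have e_gt0 : (0 < n.+1 %/ d)%N by rewrite divn_gt0 // dvdn_leq.
have nE : (n.+1 = n.+1 %/ d * d)%N by rewrite divnK.
rewrite -(Posz_count (period^~ (n.+1 %/ d)%N)).
have ks_le : all (fun k => k <= n.+1 %/ d * d)%N ks.
  by rewrite -nE; apply/allP => _ /mapP[j _ ->]; apply: ltnW (ltn_ord j).
rewrite /us [in iota 0 _]nE count_period_block //.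
have -> : all (fun k => d %| k)%N ks = (K \subset multiples_in K d).
  rewrite all_map; apply/allP/subsetP => [dK j jK | dK j].
    by rewrite inE jK /=; apply: dK; rewrite mem_enum.
  by rewrite mem_enum => /dK; rewrite inE => /andP[].
case: ifP => // /subsetP dK; rewrite -map_comp -[in iota 0 _](subn0 (n.+1 %/ d)%N).
rewrite size_permutations_block // -?map_comp //.
  have KE : multiples_in K d = K.
    by apply/setP => j; apply/idP/idP => [|/dK//]; rewrite inE => /andP[].
  have := sorted_bordered_div (ltn0Sn n) dn K_gt0.
  by rewrite KE /= div0n map_rcons rcons_path -map_comp => /andP[].
rewrite /=; apply/allP => _ /mapP[j _ ->] /=.
by apply: leq_div2r; apply: ltnW (ltn_ord j).
Qed.

Theorem theorem4 (n : nat) (n_ge1 : (1 <= n)%N)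
    (J : {set 'I_n}) (J_ge1 : forall j : 'I_n, j \in J -> (1 <= j)%N) :
  #|[set s : 'S_n | is_ncycle s && (descent_set s == J)]|%:R =
  n%:R^-1 *
  (\sum_(d <- divisors n)
     moebius d * (-1) ^+ (#|J| - #|multiples_in J d|)%N
       * \det (descent_mx J d))%:~R :> rat.
Proof.
case: n n_ge1 J J_ge1 => // n _ J J_ge1.
set A := [set s | _]; set S := \sum_(d <- _) _.
(* Clearing the factor 1/n leaves an identity between integers. *)
suff AS : (#|A| * n.+1)%N%:Z = S.
  by rewrite -AS -pmulrn natrM mulrCA mulVf ?mulr1 // Num.Theory.pnatr_eq0.
pose C (K : {set 'I_n.+1}) := [set s : 'S_n.+1 | is_ncycle s && (descent_set s \subset K)].
have cardE (P : pred 'S_n.+1) (Q : pred 'S_n.+1) :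
    #|[set s | P s && Q s]|%:Z = \sum_(s | P s) (Q s)%:Z.
  rewrite -sum1_card -natz natr_sum big_mkcond [RHS]big_mkcond /=.
  by apply: eq_bigr => s _; rewrite inE; case: (P s); case: (Q s).
(* Inclusion-exclusion is applied to the descent set of each cycle separately. *)
have -> : (#|A| * n.+1)%N%:Z = \sum_(K : {set 'I_n.+1} | K \subset J)
    (-1) ^+ (#|J| + #|K|) * (#|C K| * n.+1)%N%:Z.
  rewrite PoszM cardE (eq_bigr _ (fun s _ => esym (subset_inclusion_exclusion _ J))).
  rewrite exchange_big big_distrl /=; apply: eq_bigr => K _.
  by rewrite PoszM cardE -big_distrr mulrA.
have sub_gt0 (K : {set 'I_n.+1}) : K \subset J -> forall j : 'I_n.+1, j \in K -> (0 < j)%N.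
  by move=> /subsetP KJ j /KJ/J_ge1.
have CE (K : {set 'I_n.+1}) (KJ : K \subset J) := count_ncycles_descent_sub (sub_gt0 K KJ).
under eq_bigr => K KJ do rewrite (CE K KJ) big_distrr.
rewrite exchange_big /=.
apply: eq_big_seq => d; rewrite -dvdn_divisors // => dn.
rewrite det_descent_mx // -(beta_sum_subset (n.+1 %/ d) (fun j => val j %/ d)%N).
have JdJ : multiples_in J d \subset J by apply/subsetP => j; rewrite inE => /andP[].
rewrite big_distrr big_mkcond [RHS]big_mkcond /=; apply: eq_bigr => K _.
(* For fixed d, the contributing K are exactly the subsets of J^d, over which [beta] is a sum. *)
have KdE : (K \subset J) && (K \subset multiples_in K d) = (K \subset multiples_in J d).
  apply/andP/subsetP => [[/subsetP KJ /subsetP Kd] j jK | KJd].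
    by rewrite inE KJ //; have := Kd j jK; rewrite inE => /andP[].
  split; apply/subsetP => j jK; have := KJd j jK; rewrite !inE; first by case/andP.
  by rewrite jK => /andP[].
rewrite -KdE; case: (K \subset J) => //=; case: (K \subset _); last by rewrite !mulr0.
(* This separates the sign in the formula from the sign inside the sum for [beta]. *)
have -> : (#|J| + #|K| = (#|J| - #|multiples_in J d|) + (#|multiples_in J d| + #|K|))%N.
  by rewrite addnA subnK // subset_leq_card.
rewrite exprD; ring.
Qed.
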